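(* There exists a one-to-one correspondence between strict 3-Lie2Der pairs and crossed modules of 3-LieDer pairs.
   Context: Throughout, $\mathbb F$ is an algebraically closed field of characteristic $0$ and all vector spaces are finite-dimensional over $\mathbb F$. A 3-Lie algebra is a vector space $L$ with a skew-symmetric trilinear map $[\cdot,\cdot,\cdot]_L$ satisfying $[x_1,x_2,[x_3,x_4,x_5]]=[[x_1,x_2,x_3],x_4,x_5]+[x_3,[x_1,x_2,x_4],x_5]+[x_3,x_4,[x_1,x_2,x_5]]$. A derivation is a linear map $\theta_L:L\to L$ with $\theta_L[x,y,z]=[\theta_L x,y,z]+[x,\theta_L y,z]+[x,y,\theta_L z]$. A 3-LieDer pair $(L,\theta_L)$ is a 3-Lie algebra with a derivation; morphisms of 3-LieDer pairs are 3-Lie algebra morphisms commuting with the derivations. A representation $(V;\rho,\theta_V)$ of $(L,\theta_L)$ consists of a vector space $V$, a linear map $\rho:\wedge^2L\to\mathrm{End}(V)$ and $\theta_V\in\mathrm{End}(V)$ with $\rho(x_1,x_2)\rho(x_3,x_4)=\rho([x_1,x_2,x_3],x_4)+\rho(x_3,[x_1,x_2,x_4])+\rho(x_3,x_4)\rho(x_1,x_2)$, $\rho(x_1,[x_2,x_3,x_4])=\rho(x_3,x_4)\rho(x_1,x_2)-\rho(x_2,x_4)\rho(x_1,x_3)+\rho(x_2,x_3)\rho(x_1,x_4)$, and $\theta_V\rho(x,y)-\rho(x,y)\theta_V=\rho(\theta_Lx,y)+\rho(x,\theta_Ly)$. A strict 3-Lie 2-algebra $(V_1,V_0,d,l_3,0)$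 (a 3-Lie 2-algebra whose 5-ary operation $l_5:(\wedge^2V_0)\otimes(\wedge^3V_0)\to V_1$ is zero) consists of a complex $V_1\xrightarrow{d}V_0$ and completely skew-symmetric trilinear maps $l_3:V_i\times V_j\times V_k\to V_{i+j+k}$ ($0\le i+j+k\le1$) such that for $x,y,x_i\in V_0$, $u,v,w\in V_1$: (a) $dl_3(x,y,u)=l_3(x,y,du)$; (b) $l_3(u,v,w)=0$, $l_3(u,v,x)=0$; (c) $l_3(du,v,x)=l_3(u,dv,x)$; (d) $0=l_3(l_3(x_1,x_2,x_3),x_4,x_5)+l_3(x_3,l_3(x_1,x_2,x_4),x_5)+l_3(x_3,x_4,l_3(x_1,x_2,x_5))-l_3(x_1,x_2,l_3(x_3,x_4,x_5))$; (e) $0=l_3(l_3(u,x_2,x_3),x_4,x_5)+l_3(x_3,l_3(u,x_2,x_4),x_5)+l_3(x_3,x_4,l_3(u,x_2,x_5))-l_3(u,x_2,l_3(x_3,x_4,x_5))$; (f) $0=l_3(l_3(x_1,x_2,u),x_4,x_5)+l_3(u,l_3(x_1,x_2,x_4),x_5)+l_3(u,x_4,l_3(x_1,x_2,x_5))-l_3(x_1,x_2,l_3(u,x_4,x_5))$. A strict 2-derivation of it is $(X_0,X_1,0)$ with $X_0\in\mathrm{End}(V_0)$, $X_1\in\mathrm{End}(V_1)$ such that $X_0\circ d=d\circ X_1$; $X_0l_3(x,y,z)=l_3(X_0x,y,z)+l_3(x,X_0y,z)+l_3(x,y,X_0z)$; $X_1l_3(x,y,v)=l_3(X_0x,y,v)+l_3(x,X_0y,v)+l_3(x,y,X_1v)$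 for $x,y,z\in V_0$, $v\in V_1$. A strict 3-Lie2Der pair is a strict 3-Lie 2-algebra with a strict 2-derivation. A crossed module of 3-LieDer pairs is a quadruple $((A,\theta_A),(B,\theta_B),(A;\rho,\theta_A),\eta)$ where $(A,\theta_A)$, $(B,\theta_B)$ are 3-LieDer pairs, $(A;\rho,\theta_A)$ is a representation of $(B,\theta_B)$, and $\eta:(A,\theta_A)\to(B,\theta_B)$ is a morphism of 3-LieDer pairs such that for $u,v,w\in A$, $x,y\in B$: $\eta(\rho(x,y)(u))=[x,y,\eta(u)]_B$; $\rho(\eta(u),\eta(v))(w)=[u,v,w]_A$; $\rho(x,\eta(u))(v)=-\rho(x,\eta(v))(u)$; $\rho(x,y)[u,v,w]_A=[\rho(x,y)(u),v,w]_A+[u,\rho(x,y)(v),w]_A+[u,v,\rho(x,y)(w)]_A$. *)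

(* Defs.v *)
From HB Require Import structures.
From mathcomp Require Import all_boot all_order all_algebra.
Set Implicit Arguments.
Unset Strict Implicit.
Unset Printing Implicit Defensive.
Import GRing.Theory.
Local Open Scope ring_scope.

Definition bilinear_map (F : fieldType) (U V W : lmodType F)
    (f : U -> V -> W) : Prop :=
  (forall v, linear (fun u => f u v)) /\ (forall u, linear (f u)).

Definition trilinear_map (F : fieldType) (U V W Z : lmodType F)
    (f : U -> V -> W -> Z) : Prop :=
  [/\ forall v w, linear (fun u => f u v w),
      forall u w, linear (fun v => f u v w)
    & forall u v, linear (f u v)].

(* The adjacent transpositions generate S_3. *)
Definition skew3 (F : fieldType) (U Z : lmodType F)
    (f : U -> U -> U -> Z) : Prop :=
  (forall x y z, f x y z = - f y x z) /\ (forall x y z, f x y z = - f x z y).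

Definition is_derivation3 (F : fieldType) (L : vectType F)
    (br : L -> L -> L -> L) (theta : 'End(L)) : Prop :=
  forall x y z, theta (br x y z)
    = br (theta x) y z + br x (theta y) z + br x y (theta z).

Record threeLie (F : fieldType) (L : vectType F) : Type := ThreeLie {
  bracket :> L -> L -> L -> L;
  bracket_trilinear : trilinear_map bracket;
  bracket_skew : skew3 bracket;
  bracket_fundamental : forall x1 x2 x3 x4 x5,
    bracket x1 x2 (bracket x3 x4 x5)
      = bracket (bracket x1 x2 x3) x4 x5 + bracket x3 (bracket x1 x2 x4) x5
        + bracket x3 x4 (bracket x1 x2 x5) }.

Record threeLieDer (F : fieldType) (L : vectType F) : Type := ThreeLieDer {
  lie_bracket : threeLie L;
  lie_der : 'End(L);
  lie_derP : is_derivation3 lie_bracket lie_der }.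

Record is_morphism (F : fieldType) (L M : vectType F)
    (P : threeLieDer L) (Q : threeLieDer M) (f : 'Hom(L, M)) : Prop :=
  IsMorphism {
    morphism_bracket : forall x y z,
      f (lie_bracket P x y z) = lie_bracket Q (f x) (f y) (f z);
    morphism_der : forall x, f (lie_der P x) = lie_der Q (f x) }.

Record is_representation (F : fieldType) (L V : vectType F)
    (P : threeLieDer L) (rho : L -> L -> 'End(V)) (thetaV : 'End(V)) : Prop :=
  IsRepresentation {
    rep_bilinear : bilinear_map rho;
    rep_skew : forall x y, rho x y = - rho y x;
    rep_comp : forall x1 x2 x3 x4,
      (rho x1 x2 \o rho x3 x4)%VF
        = rho (lie_bracket P x1 x2 x3) x4 + rho x3 (lie_bracket P x1 x2 x4)
          + (rho x3 x4 \o rho x1 x2)%VF;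
    rep_bracket : forall x1 x2 x3 x4,
      rho x1 (lie_bracket P x2 x3 x4)
        = (rho x3 x4 \o rho x1 x2)%VF - (rho x2 x4 \o rho x1 x3)%VF
          + (rho x2 x3 \o rho x1 x4)%VF;
    rep_der : forall x y,
      (thetaV \o rho x y)%VF - (rho x y \o thetaV)%VF
        = rho (lie_der P x) y + rho x (lie_der P y) }.

(* The graded map l_3 is given by its components l_3 : V_i x V_j x V_k ->
   V_(i+j+k), named [l3_ijk], for the four (i, j, k) with i + j + k <= 1.  On
   two or more arguments of degree 1 it takes values in V_2 = V_3 = 0, which
   encodes l_3(u,v,w) = 0 and l_3(u,v,x) = 0; the skew-symmetry of l_3 relates
   the components through the adjacent transpositions of the arguments. *)
Record strict3Lie2 (F : fieldType) (V1 V0 : vectType F) : Type := Strict3Lie2 {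
  l_d : 'Hom(V1, V0);
  l3_000 : V0 -> V0 -> V0 -> V0;
  l3_001 : V0 -> V0 -> V1 -> V1;
  l3_010 : V0 -> V1 -> V0 -> V1;
  l3_100 : V1 -> V0 -> V0 -> V1;
  l3_000_trilinear : trilinear_map l3_000;
  l3_001_trilinear : trilinear_map l3_001;
  l3_010_trilinear : trilinear_map l3_010;
  l3_100_trilinear : trilinear_map l3_100;
  l3_000_skew : skew3 l3_000;
  l3_001_skew : forall x y u, l3_001 x y u = - l3_001 y x u;
  l3_001_010 : forall x y u, l3_001 x y u = - l3_010 x u y;
  l3_010_100 : forall x y u, l3_010 x u y = - l3_100 u x y;
  l3_100_skew : forall x y u, l3_100 u x y = - l3_100 u y x;
  l3_d : forall x y u, l_d (l3_001 x y u) = l3_000 x y (l_d u);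
  l3_peiffer : forall u v x, l3_010 (l_d u) v x = l3_100 u (l_d v) x;
  l3_fundamental0 : forall x1 x2 x3 x4 x5,
    0 = l3_000 (l3_000 x1 x2 x3) x4 x5 + l3_000 x3 (l3_000 x1 x2 x4) x5
        + l3_000 x3 x4 (l3_000 x1 x2 x5) - l3_000 x1 x2 (l3_000 x3 x4 x5);
  l3_fundamental1 : forall u x2 x3 x4 x5,
    0 = l3_100 (l3_100 u x2 x3) x4 x5 + l3_010 x3 (l3_100 u x2 x4) x5
        + l3_001 x3 x4 (l3_100 u x2 x5) - l3_100 u x2 (l3_000 x3 x4 x5);
  l3_fundamental3 : forall x1 x2 u x4 x5,
    0 = l3_100 (l3_001 x1 x2 u) x4 x5 + l3_100 u (l3_000 x1 x2 x4) x5
        + l3_100 u x4 (l3_000 x1 x2 x5) - l3_001 x1 x2 (l3_100 u x4 x5) }.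

Record is_strict_2der (F : fieldType) (V1 V0 : vectType F)
    (S : strict3Lie2 V1 V0) (X0 : 'End(V0)) (X1 : 'End(V1)) : Prop :=
  IsStrict2Der {
    der2_d : (X0 \o l_d S)%VF = (l_d S \o X1)%VF;
    der2_000 : forall x y z,
      X0 (l3_000 S x y z)
        = l3_000 S (X0 x) y z + l3_000 S x (X0 y) z + l3_000 S x y (X0 z);
    der2_001 : forall x y v,
      X1 (l3_001 S x y v)
        = l3_001 S (X0 x) y v + l3_001 S x (X0 y) v + l3_001 S x y (X1 v) }.

Record strict3Lie2Der (F : fieldType) (V1 V0 : vectType F) : Type :=
  Strict3Lie2Der {
    s2_alg : strict3Lie2 V1 V0;
    s2_X0 : 'End(V0);
    s2_X1 : 'End(V1);
    s2_derP : is_strict_2der s2_alg s2_X0 s2_X1 }.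

Record crossedModule (F : fieldType) (A B : vectType F) : Type :=
  CrossedModule {
    cm_A : threeLieDer A;
    cm_B : threeLieDer B;
    cm_rho : B -> B -> 'End(A);
    cm_eta : 'Hom(A, B);
    cm_rep : is_representation cm_B cm_rho (lie_der cm_A);
    cm_morphism : is_morphism cm_A cm_B cm_eta;
    cm_equivariant : forall x y u,
      cm_eta (cm_rho x y u) = lie_bracket cm_B x y (cm_eta u);
    cm_peiffer : forall u v w,
      cm_rho (cm_eta u) (cm_eta v) w = lie_bracket cm_A u v w;
    cm_rho_eta : forall x u v,
      cm_rho x (cm_eta u) v = - cm_rho x (cm_eta v) u;
    cm_rho_der : forall x y u v w,
      cm_rho x y (lie_bracket cm_A u v w)
        = lie_bracket cm_A (cm_rho x y u) v w
          + lie_bracket cm_A u (cm_rho x y v) w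
          + lie_bracket cm_A u v (cm_rho x y w) }.

Record strict3Lie2DerPair (F : fieldType) : Type := Strict3Lie2DerPair {
  pair_V1 : vectType F;
  pair_V0 : vectType F;
  pair_struct : strict3Lie2Der pair_V1 pair_V0 }.

Record crossedModuleOfPairs (F : fieldType) : Type := CrossedModuleOfPairs {
  cross_A : vectType F;
  cross_B : vectType F;
  cross_struct : crossedModule cross_A cross_B }.

(* A = V_1, B = V_0, eta = d, theta_A = X_1, theta_B = X_0, with
   [x,y,z]_B = l_3(x,y,z), rho(x,y)(u) = l_3(x,y,u) and
   [u,v,w]_A = l_3(du,dv,w). *)
Record corresponds (F : fieldType) (V1 V0 : vectType F)
    (S : strict3Lie2Der V1 V0) (C : crossedModule V1 V0) : Prop :=
  Corresponds {
    corr_eta : cm_eta C = l_d (s2_alg S);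
    corr_derA : lie_der (cm_A C) = s2_X1 S;
    corr_derB : lie_der (cm_B C) = s2_X0 S;
    corr_brB : forall x y z,
      lie_bracket (cm_B C) x y z = l3_000 (s2_alg S) x y z;
    corr_rho : forall x y u, cm_rho C x y u = l3_001 (s2_alg S) x y u;
    corr_brA : forall u v w,
      lie_bracket (cm_A C) u v w
        = l3_001 (s2_alg S) (l_d (s2_alg S) u) (l_d (s2_alg S) v) w }.

(* Main.v *)
Require Import Defs.
From HB Require Import structures.
From mathcomp Require Import all_boot all_order all_algebra.
From Stdlib Require Import FunctionalExtensionality ProofIrrelevance.
Import GRing.Theory.
Local Open Scope ring_scope.

(** On both sides the data are a linear map [d : V1 -> V0], a 3-Lie bracket on
    [V0], an action of pairs in [V0] on [V1], and two endomorphisms.  Indeed,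
    - skew-symmetry recovers the other mixed components of [l_3] from [l3_001],
      by [l3_100 u x y = l3_001 x y u] and [l3_010 x u y = - l3_001 x y u], so [l_3] amounts to the bracket [l3_000]
      and the action [rho x y u = l3_001 x y u];
    - the Peiffer identity [rho (eta u) (eta v) w = [u, v, w]] of a crossed
      module recovers the bracket of [A] from [eta] and [rho].

    In these terms the axioms agree.  Conditions (e) and (f) are the two
    representation identities, (a) is equivariance, and (c) is the rule
    [rho x (d u) v = - rho x (d v) u]; the three conditions on a strict
    2-derivation are the ones on [eta], on the bracket of [B] and on [rho].
    What a crossed module asks beyond this concerns the bracket of [A], and
    follows: skew-symmetry in the last two arguments is (c) at an [x] in the
    image of [d]; the derivation rule for [rho x y] is [rep_comp] with the inner
    pair of arguments in that image, where equivariance moves the bracket of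
    [V0] inside [d], and the fundamental identity is its case of [x] and [y] in
    the image; [eta] preserves brackets by equivariance; and [theta_A] is a
    derivation by its compatibility with [rho] and [X0 d = d X1].

    So each side gives an explicit structure that [corresponds] to it.  By
    functional extensionality and proof irrelevance, [corresponds] determines
    either structure from the other ([corresponds_inj_pair],
    [corresponds_inj_crossed]), which makes the two constructions mutually
    inverse. *)

(** * Linear maps from linearity proofs *)

Lemma linfun_linearE {F : fieldType} {U V : vectType F} (f : U -> V) :
  linear f -> linfun f =1 f.
Proof.
move=> fL.
pose f_lin : {linear U -> V} :=
  HB.pack f (GRing.isLinear.Build F U V *:%R f fL).
exact: (lfunE f_lin).
Qed.

Lemma linear_opp {F : fieldType} {U V : lmodType F} {f : U -> V} :
  linear f -> linear (fun u => - f u).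
Proof. by move=> fL a u v; rewrite fL opprD scalerN. Qed.

(** * The mixed components of l_3 *)

Lemma l3_100E {F : fieldType} {V1 V0 : vectType F} (S : strict3Lie2 V1 V0)
  (x y : V0) (u : V1) : l3_100 S u x y = l3_001 S x y u.
Proof. by rewrite l3_001_010 l3_010_100 opprK. Qed.

Lemma l3_010E {F : fieldType} {V1 V0 : vectType F} (S : strict3Lie2 V1 V0)
  (x y : V0) (u : V1) : l3_010 S x u y = - l3_001 S x y u.
Proof. by rewrite l3_001_010 opprK. Qed.

(** * From strict 3-Lie2Der pairs to crossed modules *)

(** The operator [rho x y] of the representation of [V0] on [V1]. *)
Definition action {F : fieldType} {V1 V0 : vectType F} (S : strict3Lie2 V1 V0)
  (x y : V0) : 'End(V1) := linfun (l3_001 S x y).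

Lemma actionE {F : fieldType} {V1 V0 : vectType F} (S : strict3Lie2 V1 V0)
  (x y : V0) : action S x y =1 l3_001 S x y.
Proof. by apply: linfun_linearE; case: (l3_001_trilinear S). Qed.

(** Condition (c), once both of its sides are written with [l3_001]. *)
Lemma l3_001_d {F : fieldType} {V1 V0 : vectType F} (S : strict3Lie2 V1 V0)
  (x : V0) (u v : V1) :
  l3_001 S x (l_d S u) v = - l3_001 S x (l_d S v) u.
Proof.
have := l3_peiffer S u v x; rewrite l3_010E l3_100E => h.
by rewrite l3_001_skew h l3_001_skew.
Qed.

(** Condition (f) written with [l3_001] only, and solved for the composite
    operator as in [rep_comp]. *)
Lemma l3_001_comp {F : fieldType} {V1 V0 : vectType F} (S : strict3Lie2 V1 V0)
  (x1 x2 x3 x4 : V0) (u : V1) :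
  l3_001 S x1 x2 (l3_001 S x3 x4 u)
    = l3_001 S (l3_000 S x1 x2 x3) x4 u + l3_001 S x3 (l3_000 S x1 x2 x4) u
      + l3_001 S x3 x4 (l3_001 S x1 x2 u).
Proof.
have /esym/eqP := l3_fundamental3 S x1 x2 u x3 x4.
by rewrite !l3_100E subr_eq0 => /eqP <-; rewrite -addrA addrC.
Qed.

(** Condition (e) in the form of [rep_bracket]; the sign in the middle is the one
    by which [l3_010] differs from [l3_001]. *)
Lemma l3_001_bracket {F : fieldType} {V1 V0 : vectType F}
  (S : strict3Lie2 V1 V0) (x1 x2 x3 x4 : V0) (u : V1) :
  l3_001 S x1 (l3_000 S x2 x3 x4) u
    = l3_001 S x3 x4 (l3_001 S x1 x2 u) - l3_001 S x2 x4 (l3_001 S x1 x3 u)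
      + l3_001 S x2 x3 (l3_001 S x1 x4 u).
Proof.
have /esym/eqP := l3_fundamental1 S u x1 x2 x3 x4.
by rewrite !l3_100E !l3_010E subr_eq0 => /eqP <-.
Qed.

Definition base_bracket {F : fieldType} {V1 V0 : vectType F}
  (S : strict3Lie2 V1 V0) : threeLie V0.
Proof.
apply: (ThreeLie (l3_000_trilinear S) (l3_000_skew S)) => x1 x2 x3 x4 x5.
by have /esym/eqP := l3_fundamental0 S x1 x2 x3 x4 x5;
   rewrite subr_eq0 => /eqP.
Defined.

Definition base_lieDer {F : fieldType} {V1 V0 : vectType F}
  (S : strict3Lie2Der V1 V0) : threeLieDer V0 :=
  @ThreeLieDer F V0 (base_bracket (s2_alg S)) (s2_X0 S) (der2_000 (s2_derP S)).

(** The bracket that the Peiffer identity forces on [V1]. *)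
Definition pulled_bracket {F : fieldType} {V1 V0 : vectType F}
  (S : strict3Lie2 V1 V0) (u v w : V1) : V1 :=
  l3_001 S (l_d S u) (l_d S v) w.

(** Each operator [l3_001 x y] is a derivation of the bracket pulled back along
    [d], because equivariance turns [l3_000 x y (d u)] into
    [d (l3_001 x y u)].  At [x = d u1], [y = d u2] this is the fundamental
    identity. *)
Lemma l3_001_pulled {F : fieldType} {V1 V0 : vectType F}
  (S : strict3Lie2 V1 V0) (x y : V0) (u v w : V1) :
  l3_001 S x y (pulled_bracket S u v w)
    = pulled_bracket S (l3_001 S x y u) v w
      + pulled_bracket S u (l3_001 S x y v) w
      + pulled_bracket S u v (l3_001 S x y w).
Proof. by rewrite /pulled_bracket l3_001_comp !l3_d. Qed.

Lemma pulled_trilinear {F : fieldType} {V1 V0 : vectType F}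
  (S : strict3Lie2 V1 V0) : trilinear_map (pulled_bracket S).
Proof.
have [L1 L2 L3] := l3_001_trilinear S.
by split=> [v w | u w | u v] a z1 z2;
  rewrite /pulled_bracket ?linearP ?(L1 _ _ a) ?(L2 _ _ a) ?(L3 _ _ a).
Qed.

Lemma pulled_skew {F : fieldType} {V1 V0 : vectType F}
  (S : strict3Lie2 V1 V0) : skew3 (pulled_bracket S).
Proof. by split=> u v w; [exact: l3_001_skew | exact: l3_001_d]. Qed.

Definition top_bracket {F : fieldType} {V1 V0 : vectType F}
  (S : strict3Lie2 V1 V0) : threeLie V1 :=
  @ThreeLie F V1 (pulled_bracket S) (pulled_trilinear S) (pulled_skew S)
    (fun u1 u2 => l3_001_pulled S (l_d S u1) (l_d S u2)).

Lemma der2_dE {F : fieldType} {V1 V0 : vectType F}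
  (S : strict3Lie2Der V1 V0) (u : V1) :
  s2_X0 S (l_d (s2_alg S) u) = l_d (s2_alg S) (s2_X1 S u).
Proof. by have /lfunP/(_ u) := der2_d (s2_derP S); rewrite !comp_lfunE. Qed.

Lemma pulled_derivation {F : fieldType} {V1 V0 : vectType F}
  (S : strict3Lie2Der V1 V0) : is_derivation3 (top_bracket (s2_alg S)) (s2_X1 S).
Proof.
move=> u v w /=.
by rewrite /pulled_bracket (der2_001 (s2_derP S)) !der2_dE.
Qed.

Definition top_lieDer {F : fieldType} {V1 V0 : vectType F}
  (S : strict3Lie2Der V1 V0) : threeLieDer V1 :=
  @ThreeLieDer F V1 (top_bracket (s2_alg S)) (s2_X1 S) (pulled_derivation S).

Lemma action_representation {F : fieldType} {V1 V0 : vectType F}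
  (S : strict3Lie2Der V1 V0) :
  is_representation (base_lieDer S) (action (s2_alg S))
    (lie_der (top_lieDer S)).
Proof.
have [L1 L2 _] := l3_001_trilinear (s2_alg S).
split.
- split=> [y | x] a z1 z2; apply/lfunP => u.
  + by rewrite add_lfunE scale_lfunE !actionE (L1 _ _ a).
  + by rewrite add_lfunE scale_lfunE !actionE (L2 _ _ a).
- by move=> x y; apply/lfunP => u; rewrite opp_lfunE !actionE l3_001_skew.
- move=> x1 x2 x3 x4; apply/lfunP => u.
  by rewrite !(add_lfunE, comp_lfunE) !actionE l3_001_comp.
- move=> x1 x2 x3 x4; apply/lfunP => u.
  by rewrite !(add_lfunE, opp_lfunE, comp_lfunE) !actionE l3_001_bracket.
- move=> x y; apply/lfunP => u.
  rewrite !(add_lfunE, opp_lfunE, comp_lfunE) !actionE /=.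
  by rewrite (der2_001 (s2_derP S)) addrK.
Qed.

Lemma d_morphism {F : fieldType} {V1 V0 : vectType F}
  (S : strict3Lie2Der V1 V0) :
  is_morphism (top_lieDer S) (base_lieDer S) (l_d (s2_alg S)).
Proof. by split=> [u v w | u] /=; rewrite ?l3_d ?der2_dE. Qed.

Definition crossed_of_pair {F : fieldType} {V1 V0 : vectType F}
  (S : strict3Lie2Der V1 V0) : crossedModule V1 V0.
Proof.
apply: (CrossedModule (action_representation S) (d_morphism S)).
- by move=> x y u; rewrite actionE l3_d.
- by move=> u v w; rewrite actionE.
- by move=> x u v; rewrite !actionE l3_001_d.
- by move=> x y u v w; rewrite !actionE l3_001_pulled.
Defined.

Lemma crossed_of_pairP {F : fieldType} {V1 V0 : vectType F}
  (S : strict3Lie2Der V1 V0) : corresponds S (crossed_of_pair S).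
Proof. by split=> // x y u; rewrite /= actionE. Qed.

(** * From crossed modules to strict 3-Lie2Der pairs *)

Lemma cm_rho_trilinear {F : fieldType} {A B : vectType F}
  (C : crossedModule A B) : trilinear_map (fun x y u => cm_rho C x y u).
Proof.
have [L1 L2] := rep_bilinear (cm_rep C).
split=> [y u | x u | x y] a z1 z2 /=.
- by rewrite (L1 _ a) add_lfunE scale_lfunE.
- by rewrite (L2 _ a) add_lfunE scale_lfunE.
- exact: linearP.
Qed.

Lemma cm_rho_skew {F : fieldType} {A B : vectType F} (C : crossedModule A B)
  (x y : B) (u : A) : cm_rho C x y u = - cm_rho C y x u.
Proof. by rewrite (rep_skew (cm_rep C)) opp_lfunE. Qed.

Definition alg_of_crossed {F : fieldType} {A B : vectType F}
  (C : crossedModule A B) : strict3Lie2 A B.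
Proof.
apply: (@Strict3Lie2 F A B (cm_eta C) (lie_bracket (cm_B C))
  (fun x y u => cm_rho C x y u) (fun x u y => - cm_rho C x y u)
  (fun u x y => cm_rho C x y u)).
- exact: bracket_trilinear.
- exact: cm_rho_trilinear.
- have [L1 L2 L3] := cm_rho_trilinear C.
  by split=> [v w | u w | u v]; apply: linear_opp;
    [exact: L1 | exact: L3 | exact: L2].
- have [L1 L2 L3] := cm_rho_trilinear C.
  by split=> [v w | u w | u v]; [exact: L3 | exact: L1 | exact: L2].
- exact: bracket_skew.
- by move=> x y u; exact: cm_rho_skew.
- by move=> x y u; rewrite opprK.
- by [].
- by move=> x y u; exact: cm_rho_skew.
- exact: cm_equivariant.
(* Condition (c): skew-symmetry puts [eta u] and [eta v] in second position,
   where [cm_rho_eta] exchanges [u] and [v]. *)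
- by move=> u v x; rewrite -cm_rho_skew cm_rho_eta -cm_rho_skew.
- by move=> x1 x2 x3 x4 x5; rewrite (bracket_fundamental _ x1) subrr.
- move=> u x2 x3 x4 x5; apply/esym/eqP; rewrite subr_eq0.
  by rewrite (rep_bracket (cm_rep C)) !(add_lfunE, opp_lfunE, comp_lfunE).
- move=> x1 x2 u x4 x5; apply/esym/eqP; rewrite subr_eq0.
  have /lfunP/(_ u) := rep_comp (cm_rep C) x1 x2 x4 x5.
  by rewrite !(add_lfunE, comp_lfunE) => ->; rewrite -addrA addrC.
Defined.

Definition pair_of_crossed {F : fieldType} {A B : vectType F}
  (C : crossedModule A B) : strict3Lie2Der A B.
Proof.
apply: (@Strict3Lie2Der F A B (alg_of_crossed C)
  (lie_der (cm_B C)) (lie_der (cm_A C))).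
split=> /=.
- by apply/lfunP => u; rewrite !comp_lfunE (morphism_der (cm_morphism C)).
- exact: lie_derP.
- move=> x y v; have /lfunP/(_ v) := rep_der (cm_rep C) x y.
  rewrite !(add_lfunE, opp_lfunE, comp_lfunE) => <-.
  by rewrite subrK.
Defined.

Lemma pair_of_crossedP {F : fieldType} {A B : vectType F}
  (C : crossedModule A B) : corresponds (pair_of_crossed C) C.
Proof. by split=> //= u v w; rewrite cm_peiffer. Qed.

(** * The correspondence determines both structures *)

Lemma funext3 {T U V W : Type} {f g : T -> U -> V -> W} :
  (forall x y z, f x y z = g x y z) -> f = g.
Proof.
move=> fg; do 3 apply: functional_extensionality => ?; exact: fg.
Qed.

Lemma threeLie_ext {F : fieldType} {L : vectType F} (b c : threeLie L) :
  (forall x y z, b x y z = c x y z) -> b = c.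
Proof.
case: b c => [b b1 b2 b3] [c c1 c2 c3] /= /funext3 bc; case: c / bc c1 c2 c3.
by move=> c1 c2 c3; f_equal; apply: proof_irrelevance.
Qed.

Lemma threeLieDer_ext {F : fieldType} {L : vectType F} (P Q : threeLieDer L) :
  (forall x y z, lie_bracket P x y z = lie_bracket Q x y z) ->
  lie_der P = lie_der Q -> P = Q.
Proof.
case: P Q => [b s p] [c t q] /= /threeLie_ext bc st.
by case: c / bc q => q; case: t / st q => q; f_equal; apply: proof_irrelevance.
Qed.

Lemma crossedModule_ext {F : fieldType} {A B : vectType F}
  (C D : crossedModule A B) :
  cm_A C = cm_A D -> cm_B C = cm_B D ->
  (forall x y u, cm_rho C x y u = cm_rho D x y u) -> cm_eta C = cm_eta D ->
  C = D.
Proof.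
case: C D => [A1 B1 r1 e1 p1 q1 s1 t1 w1 z1] [A2 B2 r2 e2 p2 q2 s2 t2 w2 z2] /=.
move=> EA EB Er Ee.
have {}Er : r1 = r2.
  by do 2 apply: functional_extensionality => ?; apply/lfunP => u; exact: Er.
subst; f_equal; exact: proof_irrelevance.
Qed.

(** The components [l3_010] and [l3_100] follow from [l3_001] by skew-symmetry,
    so agreement of [l_d], [l3_000] and [l3_001] suffices. *)
Lemma strict3Lie2_ext {F : fieldType} {V1 V0 : vectType F}
  (S T : strict3Lie2 V1 V0) :
  l_d S = l_d T ->
  (forall x y z, l3_000 S x y z = l3_000 T x y z) ->
  (forall x y u, l3_001 S x y u = l3_001 T x y u) ->
  S = T.
Proof.
move=> Ed E000 E001.
have E010 x u y : l3_010 S x u y = l3_010 T x u y by rewrite !l3_010E E001.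
have E100 u x y : l3_100 S u x y = l3_100 T u x y by rewrite !l3_100E E001.
move: Ed (funext3 E000) (funext3 E001) (funext3 E010) (funext3 E100).
case: S T {E000 E001 E010 E100} => ? ? ? ? ? ? ? ? ? ? ? ? ? ? ? ? ? ? ?.
case=> ? ? ? ? ? ? ? ? ? ? ? ? ? ? ? ? ? ? ? /= *.
by subst; congr Strict3Lie2; exact: proof_irrelevance.
Qed.

Lemma strict3Lie2Der_ext {F : fieldType} {V1 V0 : vectType F}
  (S T : strict3Lie2Der V1 V0) :
  s2_alg S = s2_alg T -> s2_X0 S = s2_X0 T -> s2_X1 S = s2_X1 T -> S = T.
Proof.
case: S T => [a X0 X1 p] [b Y0 Y1 q] /= *.
subst; f_equal; exact: proof_irrelevance.
Qed.

Lemma corresponds_inj_pair {F : fieldType} {V1 V0 : vectType F}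
  (S T : strict3Lie2Der V1 V0) (C : crossedModule V1 V0) :
  corresponds S C -> corresponds T C -> S = T.
Proof.
case=> e1 a1 b1 B1 r1 _ [e2 a2 b2 B2 r2 _]; apply: strict3Lie2Der_ext.
- apply: strict3Lie2_ext => [|x y z|x y u].
  + by rewrite -e1 -e2.
  + by rewrite -B1 -B2.
  + by rewrite -r1 -r2.
- by rewrite -b1 -b2.
- by rewrite -a1 -a2.
Qed.

Lemma corresponds_inj_crossed {F : fieldType} {V1 V0 : vectType F}
  (S : strict3Lie2Der V1 V0) (C D : crossedModule V1 V0) :
  corresponds S C -> corresponds S D -> C = D.
Proof.
case=> e1 a1 b1 B1 r1 A1 [e2 a2 b2 B2 r2 A2]; apply: crossedModule_ext.
- by apply: threeLieDer_ext => [x y z|]; rewrite ?A1 ?A2 ?a1 ?a2.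
- by apply: threeLieDer_ext => [x y z|]; rewrite ?B1 ?B2 ?b1 ?b2.
- by move=> x y u; rewrite r1 r2.
- by rewrite e1 e2.
Qed.

Lemma crossed_of_pairK {F : fieldType} {V1 V0 : vectType F} :
  cancel (@crossed_of_pair F V1 V0) pair_of_crossed.
Proof.
move=> S; apply: corresponds_inj_pair (crossed_of_pairP S).
exact: pair_of_crossedP.
Qed.

Lemma pair_of_crossedK {F : fieldType} {V1 V0 : vectType F} :
  cancel (@pair_of_crossed F V1 V0) crossed_of_pair.
Proof.
move=> C; apply: corresponds_inj_crossed (pair_of_crossedP C).
exact: crossed_of_pairP.
Qed.

Theorem proposition5p2 (F : closedFieldType) (charF0 : [pchar F] =i pred0) :
  exists Phi : forall V1 V0 : vectType F,
      strict3Lie2Der V1 V0 -> crossedModule V1 V0,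
    [/\ forall (V1 V0 : vectType F) (S : strict3Lie2Der V1 V0),
          corresponds S (Phi V1 V0 S),
        forall V1 V0 : vectType F, bijective (Phi V1 V0)
      & bijective (fun P : strict3Lie2DerPair F =>
          CrossedModuleOfPairs
            (Phi (pair_V1 P) (pair_V0 P) (pair_struct P)))].
Proof.
exists (@crossed_of_pair F); split.
- by move=> V1 V0; exact: crossed_of_pairP.
- move=> V1 V0; exists pair_of_crossed.
  + exact: crossed_of_pairK.
  + exact: pair_of_crossedK.
- exists (fun C : crossedModuleOfPairs F =>
    Strict3Lie2DerPair (pair_of_crossed (cross_struct C))).
  + by case=> V1 V0 S /=; rewrite crossed_of_pairK.
  + by case=> A B C /=; rewrite pair_of_crossedK.
Qed.
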